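(* Let $k\geq 1$ be an integer, and let $c$ and $d$ be constants with $c>1$ and $0<d<1$. Set $c_0=\max\{2,(24\ln c)^{\frac{1}{1-d}}\}$. Then every simple digraph of order at most $c^{r^d}$ whose minimum out-degree $r$ satisfies $r\geq c_0\max\{k^{\frac{1}{1-d}},k^2\}$ contains at least $k$ pairwise vertex-disjoint directed cycles whose lengths are pairwise different.
   Context: A simple digraph is finite, without loops and without multiple arcs (two opposite arcs between the same pair of vertices are allowed). The length of a directed cycle is its number of vertices. *)

(* Defs.v *)
From mathcomp Require Import all_boot all_order all_algebra.
From mathcomp Require Import reals exp.

Set Implicit Arguments.
Unset Strict Implicit.
Unset Printing Implicit Defensive.

Import Order.TTheory GRing.Theory Num.Theory.

Local Open Scope ring_scope.

(* A simple digraph is a finType of vertices together with an irreflexive     *)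
(* arc relation; opposite arcs are allowed, multiple arcs cannot occur.       *)
Definition simple_digraph (T : finType) (e : rel T) : Prop := irreflexive e.

Definition outdeg (T : finType) (e : rel T) (v : T) : nat := #|[set w | e v w]|.

(* Out-degrees never exceed #|T|, so the default value of the big minimum is  *)
(* harmless; it is only reached on the empty digraph, where the result is 0.  *)
Definition min_outdeg (T : finType) (e : rel T) : nat :=
  \big[minn/#|T|]_(v : T) outdeg e v.

(* The list of distinct vertices of a directed cycle in cyclic order, so its  *)
(* length is its size. A one-vertex list would need a loop, so size 1 is      *)
(* excluded in a simple digraph; size 2 is a pair of opposite arcs.           *)
Definition dicycle (T : finType) (e : rel T) (p : seq T) : Prop :=
  p <> [::] /\ ucycle e p.

Definition c0 (R : realType) (c d : R) : R :=
  Num.max 2 ((24 * ln c) `^ (1 / (1 - d))).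

(* Main.v *)
Require Import Defs.
From mathcomp Require Import all_boot all_order all_algebra.
From mathcomp Require Import reals exp.
From mathcomp Require Import sequences.
From mathcomp Require Import zify ring lra.

Set Implicit Arguments.
Unset Strict Implicit.
Unset Printing Implicit Defensive.

Import Order.TTheory GRing.Theory Num.Theory.

Local Open Scope ring_scope.

(* Colour the vertices with k colours uniformly at random. The hypotheses      *)
(* amount to r >= 2 k^2 and r >= 24 k ln #|T|, so by a Chernoff bound and a     *)
(* union bound some colouring gives every vertex at least k out-neighbours of   *)
(* each colour. In each colour class all out-neighbours of the end of a longest *)
(* path lie on that path, which yields k cycles of different lengths; so one    *)
(* can choose greedily one cycle per class, avoiding the lengths already used.  *)

(** The tail estimate is Markov's inequality for 2^-X, where X counts the out-neighbours of a vertex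
    in one colour: X < k has probability at most 2^k E(2^-X) <= 2^k e^(-r/(2k))
    ([sum_half_colour_count]). Over all vertices and colours the failures sum to less than 1
    ([order_degree_bounds], [union_bound_lt1]), hence [colouring_large_degrees]. The greedy choice
    of cycles is [disjoint_dicycles_of_colouring], each step resting on
    [dicycle_avoiding_lengths]. *)

Lemma min_outdeg_le (T : finType) (e : rel T) (v : T) :
  (min_outdeg e <= outdeg e v)%N.
Proof.
rewrite /min_outdeg; have := mem_index_enum v.
elim: (index_enum T) => // x s IHs; rewrite inE big_cons.
case/orP=> [/eqP<-|/IHs]; first exact: geq_minl.
by apply: leq_trans; exact: geq_minr.
Qed.

Lemma min_outdeg_le_card (T : finType) (e : rel T) : (min_outdeg e <= #|T|)%N.
Proof.
rewrite /min_outdeg; elim: (index_enum T) => [|x s IHs]; first by rewrite big_nil.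
by rewrite big_cons; apply: leq_trans IHs; exact: geq_minr.
Qed.

(** The path is stored against its arcs: the head [x] is its last vertex, so extending it along an
    arc out of [x] is a cons, which maximality forbids. *)
Lemma longest_path (T : finType) (e : rel T) (S : {set T}) (x0 : T) :
    x0 \in S ->
  exists x p, [/\ path (fun a b => e b a) x p, uniq (x :: p),
    {subset x :: p <= S} & forall y, y \in S -> e x y -> y \in x :: p].
Proof.
move=> x0S.
pose good n := [exists t : n.+1.-tuple T,
  [&& path (fun a b => e b a) (thead t) (behead t), uniq t & all (mem S) t]].
have good0 : exists n, good n.
  exists 0%N; apply/existsP; exists [tuple x0].
  by rewrite /= x0S.
have goodT n : good n -> (n <= #|T|)%N.
  case/existsP=> t /and3P[_ /card_uniqP + _].
  by rewrite size_tuple => /esym/eq_leq/ltnW/leq_trans; apply; exact: max_card.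
case: (ex_maxnP good0 goodT) => n /existsP[t /and3P[pt ut /allP St]] maxn.
case/tupleP: t pt ut St => x p /=; rewrite theadE => pt ut St.
exists x, p; split=> // y yS exy; apply: contraT => yp.
suff /maxn : good n.+1 by rewrite ltnn.
apply/existsP; exists [tuple of y :: x :: p] => /=.
rewrite theadE /= exy pt yS; move: yp ut => /= -> -> /=.
exact: (introT allP St).
Qed.

(** Let [x] end a longest path in [S]. Each out-neighbour of [x] in [S] lies on the path and closes
    its final segment into a cycle; different out-neighbours give different lengths, more of them
    than [L] can contain. *)
Lemma dicycle_avoiding_lengths (T : finType) (e : rel T) (S : {set T}) (x0 : T)
    (L : seq nat) :
    x0 \in S -> (forall v, v \in S -> (size L < #|[set w in S | e v w]|)%N) ->
  exists p, [/\ dicycle e p, {subset p <= S} & size p \notin L].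
Proof.
move=> x0S degS; have [x [p [pxp uxp Sp maxp]]] := longest_path e x0S.
pose N := [set w in S | e x w].
have Np y : y \in N -> y \in x :: p by rewrite inE => /andP[]; exact: maxp.
(* Number of vertices from [y] to [x] along the path, hence the length of the cycle closed by the
   arc from [x] to [y]. *)
pose len y := (index y (x :: p)).+1.
have /hasP[y yN lenyL] : has (fun y => len y \notin L) (enum N).
  apply: contraT; rewrite -all_predC => /allP lenL.
  have: (size (map len (enum N)) <= size L)%N.
    apply: uniq_leq_size.
      rewrite map_inj_in_uniq ?enum_uniq // => a b.
      rewrite !mem_enum => /Np ap /Np bp [] eqi.
      by rewrite -(nth_index x ap) -(nth_index x bp) /= eqi.
    by move=> _ /mapP[a /lenL /negPn + ->].
  by rewrite size_map -cardE leqNgt degS // Sp // mem_head.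
rewrite mem_enum in yN; have yp := Np y yN.
move: yN; rewrite inE => /andP[_ exy].
have szi : (index y (x :: p) < size (x :: p))%N by rewrite index_mem.
pose q := take (index y (x :: p)) p.
have eq_take : x :: q = take (len y) (x :: p) by [].
have szq : size q = index y (x :: p) by rewrite size_takel // -ltnS.
have lastq : last x q = y.
  by rewrite (last_nth x) szq eq_take nth_take // nth_index.
(* Reversal restores the direction of the arcs. *)
exists (rev (x :: q)); split.
- split; first by move/(congr1 size); rewrite size_rev.
  rewrite /ucycle rev_uniq eq_take take_uniq // andbT rev_cycle.
  rewrite /= rcons_path lastq exy andbT.
  by apply: take_path.
- by move=> z; rewrite mem_rev eq_take => /mem_take; exact: Sp.
- by rewrite size_rev eq_take size_takel.
Qed.

(** Colour classes are disjoint, and fewer than k lengths are taken whenever a class is treated. The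
    vertex [x0] serves to show that every class is inhabited. *)
Lemma disjoint_dicycles_of_colouring (T : finType) (e : rel T) (k : nat)
    (f : T -> 'I_k) (x0 : T) :
    (forall v i, (k <= #|[set w | e v w & f w == i]|)%N) ->
  exists C : 'I_k -> seq T,
    [/\ forall i : 'I_k, dicycle e (C i),
        forall i j : 'I_k, i != j -> [disjoint C i & C j]
      & forall i j : 'I_k, i != j -> size (C i) <> size (C j)].
Proof.
move=> degf.
pose S i := [set w | f w == i].
have cyc i (L : seq nat) : (size L < k)%N ->
    exists p, [/\ dicycle e p, {subset p <= S i} & size p \notin L].
  move=> ltLk.
  have /card_gt0P[x] : (0 < #|[set w | e x0 w & f w == i]|)%N.
    by apply: leq_trans (degf x0 i); exact: leq_ltn_trans ltLk.
  rewrite inE => /andP[_ fx]; apply: (@dicycle_avoiding_lengths _ _ _ x).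
    by rewrite inE.
  move=> v _; apply: leq_trans ltLk (leq_trans (degf v i) _).
  by apply: subset_leq_card; apply/subsetP=> w; rewrite !inE andbC.
have greedy m : (m <= k)%N -> exists C : nat -> seq T,
    (forall i : 'I_k, (i < m)%N -> dicycle e (C i) /\ {subset C i <= S i}) /\
    uniq [seq size (C i) | i <- iota 0 m].
  elim: m => [|m IHm] ltmk; first by exists (fun=> [::]).
  have [C [HC uC]] := IHm (ltnW ltmk).
  have [|p [cp Sp Lp]] := cyc (Ordinal ltmk) [seq size (C i) | i <- iota 0 m].
    by rewrite size_map size_iota.
  exists (fun i => if i == m then p else C i); split=> [i|].
    rewrite ltnS leq_eqVlt; case: eqVneq => [im _|_ /=]; last exact: HC.
    by rewrite (_ : i = Ordinal ltmk) //; exact: val_inj.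
  rewrite -addn1 iotaD map_cat /= add0n eqxx cats1 rcons_uniq.
  rewrite (_ : map _ _ = [seq size (C i) | i <- iota 0 m]) ?Lp //.
  by apply/eq_in_map=> i; rewrite mem_iota add0n => /ltn_eqF ->.
have [C [HC uC]] := greedy k (leqnn k).
exists (fun i => C i); split=> [i|i j neij|i j neij].
- by have [] := HC i (ltn_ord i).
- rewrite disjoint_has; apply/hasPn=> x xi; apply: contra neij => xj.
  have [_ /(_ x xi)] := HC i (ltn_ord i); have [_ /(_ x xj)] := HC j (ltn_ord j).
  by rewrite !inE => /eqP -> /eqP ->.
- move=> eqs; move/negP: neij; apply; rewrite -val_eqE /=.
  rewrite -(nth_uniq 0%N _ _ uC) ?size_map ?size_iota //.
  by rewrite !(nth_map 0%N) ?size_iota // !nth_iota // !add0n eqs.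
Qed.

(* Divided by k ^ #|T|, the left-hand side is the expectation of 2^-X, where X *)
(* counts the elements of N receiving the colour i in a uniform k-colouring.   *)
Lemma sum_half_colour_count (R : realType) (T : finType) (k : nat) (N : {set T})
    (i : 'I_k) :
  \sum_(f : {ffun T -> 'I_k}) 2^-1 ^+ #|[set w in N | f w == i]|
    <= k%:R ^+ #|T| * expR (- (2 * k%:R)^-1) ^+ #|N| :> R.
Proof.
have k0 : 0 < k%:R :> R by rewrite ltr0n; case: (k) i => [[]|].
pose g w j : R := if (w \in N) && (j == i) then 2^-1 else 1.
under eq_bigr => f _.
  rewrite (_ : _ ^+ _ = \prod_w g w (f w)); last first.
    rewrite -big_mkcond -prodr_const; apply: eq_bigl => w.
    by rewrite inE.
  over.
(* Independence of the vertices: the sum over colourings of a product over vertices is the product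
   over vertices of sums over colours, so one vertex [w] can be treated at a time. *)
rewrite -bigA_distr_bigA -[X in _ <= X * _]prodr_const -[X in _ <= _ * X]prodr_const.
rewrite [X in _ <= _ * X]big_mkcond -big_split /=; apply: ler_prod => w _.
apply/andP; split; first by apply: sumr_ge0 => j _; rewrite /g; case: ifP; lra.
rewrite /g; case: ifP => wN /=; last by rewrite sumr_const card_ord mulr1.
rewrite (bigD1 i) //= eqxx (eq_bigr (fun=> 1)); last by move=> j /negbTE ->.
rewrite sumr_const cardC1 card_ord.
(* A vertex of [N] contributes k (1 - 1/(2k)), and 1 + t <= e^t applies. *)
have -> : 2^-1 + 1 *+ k.-1 = k%:R * (1 + - (2 * k%:R)^-1) :> R.
  rewrite -subn1 natrB -?(ltr0n R) //; field.
  by rewrite gt_eqF.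
by rewrite ler_pM2l // expR_ge1Dx.
Qed.

(** First-moment argument by counting: if every colouring failed at some vertex and colour, summing
    the weights 2^(k-X) over all colourings would give at least k^#|T|, against the assumed
    bound. *)
Lemma colouring_large_degrees (R : realType) (T : finType) (e : rel T) (k r : nat) :
    (0 < k)%N -> (forall v, (r <= outdeg e v)%N) ->
    #|T|%:R * k%:R * 2 ^+ k * expR (- (2 * k%:R)^-1) ^+ r < 1 :> R ->
  exists f : {ffun T -> 'I_k},
    forall v i, (k <= #|[set w | e v w & f w == i]|)%N.
Proof.
move=> k0 degr lt1.
pose X (f : {ffun T -> 'I_k}) v i := #|[set w | e v w & f w == i]|.
suff /existsP[f /forallP fP] : [exists f, [forall v, [forall i, k <= X f v i]]]%N.
  by exists f => v i; have /forallP := fP v; apply.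
apply: contraLR lt1; rewrite negb_exists => /forallP bad; rewrite -leNgt.
have kn0 : 0 < k%:R ^+ #|T| :> R by rewrite exprn_gt0 ?ltr0n.
rewrite -(ler_pM2l kn0) mulr1.
rewrite [leLHS](_ : _ = \sum_(f : {ffun T -> 'I_k}) 1); last first.
  by rewrite sumr_const card_ffun card_ord natrX.
pose F f v i : R := 2 ^+ k * 2^-1 ^+ X f v i.
have F0 f v i : 0 <= F f v i by rewrite /F mulr_ge0 ?exprn_ge0 ?invr_ge0.
apply: (@le_trans _ _ (\sum_f \sum_v \sum_i F f v i)).
  apply: ler_sum => f _.
  have := bad f; rewrite negb_forall => /existsP[v].
  rewrite negb_forall => /existsP[i]; rewrite -ltnNge => /ltnW ltXk.
  (* The failing pair alone contributes 2^(k-X) >= 1; the other terms are nonnegative. *)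
  rewrite (bigD1 v) //= (bigD1 i) //= -addrA ler_wpDr //.
    by rewrite addr_ge0 ?sumr_ge0 // => w _; rewrite sumr_ge0.
  by rewrite /F exprVn -expfB_cond ?pnatr_eq0 // exprn_ege1 ?ler1n.
rewrite exchange_big /=; under eq_bigr do rewrite exchange_big /=.
apply: (@le_trans _ _ (\sum_(v : T) \sum_(i < k)
    2 ^+ k * (k%:R ^+ #|T| * expR (- (2 * k%:R)^-1) ^+ r))).
  apply: ler_sum => v _; apply: ler_sum => i _.
  rewrite -mulr_sumr ler_pM2l ?exprn_gt0 //.
  have := sum_half_colour_count R [set w | e v w] i.
  have setE (f : {ffun T -> 'I_k}) :
      [set w in [set w | e v w] | f w == i] = [set w | e v w & f w == i].
    by apply/setP=> w; rewrite !inE.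
  under eq_bigr => f _ do rewrite setE.
  move=> /le_trans; apply; rewrite ler_pM2l //.
  apply: ler_wiXn2l; [exact: expR_ge0| |exact: degr].
  by rewrite -[leRHS]expR0 ler_expR oppr_le0 invr_ge0 mulr_ge0.
set E := expR _ ^+ r.
rewrite [leLHS](_ : _ = #|T|%:R * (k%:R * (2 ^+ k * (k%:R ^+ #|T| * E)))).
  by rewrite le_eqVlt; apply/orP; left; apply/eqP; ring.
by rewrite !sumr_const card_ord !mulr_natl.
Qed.

(* With x = r / (8 k), the factor e^(-4x) beats 2^k because x >= k / 4 and      *)
(* e^(3/4) > 2, and it beats n k < n^3 because x >= 3 ln n.                     *)
Lemma union_bound_lt1 (R : realType) (n k r : nat) :
    (0 < k)%N -> (2 * k ^ 2 <= r)%N -> (r <= n)%N ->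
    24 * k%:R * ln n%:R <= r%:R :> R ->
  n%:R * k%:R * 2 ^+ k * expR (- (2 * k%:R)^-1) ^+ r < 1 :> R.
Proof.
move=> k0 kr rn lnr.
have k0R : 0 < k%:R :> R by rewrite ltr0n.
(* These two bounds give n k <= n^2 < n^3, the source of the strict inequality. *)
have kn : (k <= n)%N by nia.
have n2 : (2 <= n)%N by nia.
have n0R : 0 < n%:R :> R by rewrite ltr0n; lia.
pose x : R := r%:R / (8 * k%:R).
have -> : expR (- (2 * k%:R)^-1) ^+ r = (expR x * expR (3 * x))^-1.
  rewrite -expRM_natl -expRD -expRN; congr expR.
  by rewrite /x; field; rewrite gt_eqF.
have two_exp : 2 ^+ k <= expR (3 * x).
  (* This is e^(3/4) >= (1 + 1/8)^6 > 2. *)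
  have two_le : 2 <= expR (8^-1 : R) ^+ 6.
    apply: (@le_trans _ _ ((1 + 8^-1) ^+ 6)); first by lra.
    by rewrite ler_pXn2r ?nnegrE ?expR_ge0 ?expR_ge1Dx //; lra.
  apply: (@le_trans _ _ ((expR (8^-1) ^+ 6) ^+ k)).
    by rewrite ler_pXn2r ?nnegrE ?exprn_ge0 ?expR_ge0.
  rewrite -!expRM_natl ler_expR.
  suff : k%:R / 4 <= x by lra.
  have : 2 * k%:R ^+ 2 <= r%:R :> R by rewrite -natrX -natrM ler_nat.
  by rewrite /x ler_pdivlMr ?mulr_gt0 //; lra.
have n_exp : n%:R ^+ 3 <= expR x.
  rewrite -{1}[n%:R]lnK ?posrE // -expRM_natl ler_expR /x ler_pdivlMr ?mulr_gt0 //.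
  by lra.
rewrite ltr_pdivrMr ?mulr_gt0 ?expR_gt0 // mul1r.
apply: lt_le_trans (ler_pM _ _ n_exp two_exp); rewrite ?exprn_ge0 //.
rewrite ltr_pM2r ?exprn_gt0 // -natrM -natrX ltr_nat.
by nia.
Qed.

(** Choosing the entries 2 and k^2 of the two maxima gives the first bound. The other two entries
    give r >= (24 k ln c)^(1/(1-d)), that is r^(1-d) >= 24 k ln c; multiplying by r^d and using ln n
    <= r^d ln c gives the second. *)
Lemma order_degree_bounds (R : realType) (k n r : nat) (c d : R) :
    (1 <= k)%N -> 1 < c -> 0 < d -> d < 1 -> (0 < n)%N ->
    n%:R <= c `^ (r%:R `^ d) ->
    c0 c d * Num.max (k%:R `^ (1 / (1 - d))) (k%:R ^+ 2) <= r%:R ->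
  (2 * k ^ 2 <= r)%N /\ 24 * k%:R * ln n%:R <= r%:R :> R.
Proof.
move=> hk hc hd0 hd1 n0 horder hdeg.
have lnc : 0 < ln c by exact: ln_gt0.
have k0 : 0 < k%:R :> R by rewrite ltr0n.
have kr : (2 * k ^ 2 <= r)%N.
  rewrite -(ler_nat R) natrM natrX; apply: le_trans hdeg.
  by apply: ler_pM => //; rewrite ?exprn_ge0 // /c0 le_max lexx ?orbT.
split=> //.
have r0 : 0 < r%:R :> R by rewrite ltr0n; apply: leq_trans kr; rewrite muln_gt0 expn_gt0 hk.
have lnn : ln n%:R <= r%:R `^ d * ln c.
  by rewrite -ln_powR ler_ln // ?posrE ?ltr0n ?powR_gt0 //; lra.
have pw : 24 * ln c * k%:R <= r%:R `^ (1 - d).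
  have d1 : 1 - d != 0 by lra.
  have base0 : 0 <= 24 * ln c * k%:R by rewrite !mulr_ge0 // ltW.
  rewrite [leLHS](_ : _ = (24 * ln c * k%:R) `^ (1 / (1 - d)) `^ (1 - d));
    last first.
    by rewrite -powRrM mul1r mulVf // powRr1.
  apply: ge0_ler_powR; rewrite ?nnegrE ?powR_ge0 //; first by lra.
  apply: le_trans hdeg; rewrite powRM ?mulr_ge0 ?(ltW lnc) //.
  by apply: ler_pM; rewrite ?powR_ge0 // /c0 le_max lexx ?orbT.
have -> : r%:R = r%:R `^ (1 - d) * r%:R `^ d :> R.
  by rewrite -powRD ?subrK ?powRr1 // ?ltW // gt_eqF // implybT.
apply: (@le_trans _ _ (24 * k%:R * (r%:R `^ d * ln c))).
  by rewrite ler_pM2l // mulr_gt0.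
rewrite (_ : 24 * _ * _ = (24 * ln c * k%:R) * r%:R `^ d); last by ring.
by rewrite ler_wpM2r ?powR_ge0.
Qed.

Theorem theorem3p11 (R : realType) (k : nat) (hk : (1 <= k)%N)
    (c d : R) (hc : 1 < c) (hd0 : 0 < d) (hd1 : d < 1)
    (T : finType) (e : rel T) (he : simple_digraph e)
    (r : nat) (hr : min_outdeg e = r)
    (horder : #|T|%:R <= c `^ (r%:R `^ d))
    (hdeg : c0 c d * Num.max (k%:R `^ (1 / (1 - d))) (k%:R ^+ 2) <= r%:R) :
  exists C : 'I_k -> seq T,
    [/\ forall i : 'I_k, dicycle e (C i),
        forall i j : 'I_k, i != j -> [disjoint C i & C j]
      & forall i j : 'I_k, i != j -> size (C i) <> size (C j)].
Proof.
have rT : (r <= #|T|)%N by rewrite -hr min_outdeg_le_card.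
(* Positivity of [r] rules out the empty digraph. *)
have r0 : (0 < r)%N.
  rewrite -(ltr0n R); apply: lt_le_trans hdeg.
  by rewrite mulr_gt0 // lt_max ?ltr0n // exprn_gt0 ?orbT // ltr0n.
have T0 : (0 < #|T|)%N := leq_trans r0 rT.
have [kr lnr] := order_degree_bounds hk hc hd0 hd1 T0 horder hdeg.
have degr v : (r <= outdeg e v)%N by rewrite -hr min_outdeg_le.
have [f degf] := colouring_large_degrees hk degr (union_bound_lt1 hk kr rT lnr).
have /card_gt0P[x0 _] := T0.
exact: disjoint_dicycles_of_colouring x0 degf.
Qed.
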